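(* Let $p$ be an odd prime, $\zeta_p = e^{2\pi i/p}$, and $S = \mathbb{Q}((1+\sqrt{2})^{1/p}, \zeta_p)$, where $(1+\sqrt{2})^{1/p}$ is the positive real $p$th root. Then: (1) $\operatorname{Gal}(S/\mathbb{Q}(\zeta_p)) \cong D_{2p}$; (2) if $D_{2p} = \langle \sigma, \tau \mid \sigma^p = \tau^2 = 1, \tau^{-1}\sigma\tau = \sigma^{-1}\rangle$ and $\varphi : (\mathbb{Z}/p\mathbb{Z})^\times \to \operatorname{Aut}(D_{2p})$ is the map $k \mapsto \varphi_k$ with $\varphi_k(\tau) = \tau$, $\varphi_k(\sigma) = \sigma^k$, then $\operatorname{Gal}(S/\mathbb{Q}) \cong D_{2p} \rtimes_\varphi (\mathbb{Z}/p\mathbb{Z})^\times$.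
   Context: $D_{2p}$ denotes the dihedral group of order $2p$. *)

(* Defs.v *)
From HB Require Import structures.
From mathcomp Require Import all_boot all_order all_algebra all_fingroup all_solvable all_field.
Set Implicit Arguments.
Unset Strict Implicit.
Unset Printing Implicit Defensive.
Import GRing.Theory Num.Theory.

(* [s; t] realise the presentation < s, t | s^n = t^2 = 1, t^-1 s t = s^-1 >
   of the group D: they lie in D, generate D and satisfy the relations.
   (For D = 'D_(2n) this identifies D with the presented group, since the
   presented group has order at most 2n.)  Note: in MathComp, s ^ t is the
   conjugate t^-1 * s * t. *)
Definition dihedral_pres (gT : finGroupType) (D : {set gT}) (n : nat) (s t : gT) :=
  [/\ s \in D, t \in D & <<[set s; t]>>%g = D] /\
  [/\ (s ^+ n = 1)%g, (t ^+ 2 = 1)%g & (s ^ t = s^-1)%g].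

Definition rootp_1sqrt2 (p : nat) : algC := (p.-root (1 + sqrtC 2))%R.

(* zeta_p = exp(2 pi i / p): p.-root (-1) is exp(i pi / p) (the root of
   minimal nonnegative argument), so its square is exp(2 pi i / p). *)
Definition zeta (p : nat) : algC := (p.-root (-1) ^+ 2)%R.

(* Main.v *)
(** Write zeta for the primitive p-th root of unity and w = r^p - 1 = sqrt 2.
    An automorphism sends r to zeta^j r or to -zeta^j / r according to the sign
    it gives to w, since (1 - sqrt 2)(1 + sqrt 2) = -1 and p is odd.  All pairs
    (exponent of zeta, sign of w) occur, by restricting automorphisms of the
    8p-th cyclotomic field, which contains sqrt 2.  It remains to see that r is
    not in the abelian field Q(zeta, sqrt 2): otherwise complex conjugation
    commutes with every automorphism on r, so r is only sent to r or -1/r, and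
    r - 1/r is a rational algebraic integer, hence at least 1; then r^3 >= 3,
    whereas r^p = 1 + sqrt 2 < 3.  So there are sigma : r |-> zeta r and
    tau : r |-> -1/r over Q(zeta), generating the dihedral group, and the
    automorphisms zeta |-> zeta^k fixing r form a complement. *)

Require Import Defs.
From HB Require Import structures.
From mathcomp Require Import all_boot all_order all_algebra all_fingroup all_solvable all_field.
Set Implicit Arguments.
Unset Strict Implicit.
Unset Printing Implicit Defensive.
Import Order.TTheory GRing.Theory Num.Theory.

(** * Groups generated by an element of order p and an involution inverting it *)

Section DihedralPresentation.
Local Open Scope group_scope.
Variable p : nat.
Hypotheses (p_pr : prime p) (p_odd : odd p).

Lemma dihedral_sdprod (gT : finGroupType) (s t : gT) :
    #[s] = p -> #[t] = 2 -> s ^ t = s^-1 ->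
  <[s]> ><| <[t]> = <<[set s; t]>>.
Proof.
move=> os ot st; have nst : <[t]> \subset 'N(<[s]>).
  by rewrite cycle_subG; apply/normP; rewrite -cycleJ st cycleV.
rewrite sdprodEY //; first by rewrite joing_idl joing_idr.
by rewrite coprime_TIg // -!orderE os ot coprimen2.
Qed.

(** The orders divide p and 2, and [D] is the product of the two cyclic groups, so 2p is at most the
    product of the orders; only p and 2 are large enough. *)
Lemma dihedral_pres_orders (gT : finGroupType) (D : {group gT}) (s t : gT) :
  #|D| = p.*2 -> dihedral_pres D p s t -> #[s] = p /\ #[t] = 2.
Proof.
move=> oD [[Ds Dt genD] [sp t2 st]].
have p_gt2 : 2 < p by case: (p) p_pr p_odd => [|[|[|]]].
have ot : #[t] = 1%N \/ #[t] = 2.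
  have /prime_nt_dvdP : #[t] %| 2 by rewrite order_dvdn t2.
  by have [->|ne /(_ isT)] := eqVneq #[t] 1%N; [left | right; auto].
have nst : <[t]> \subset 'N(<[s]>).
  by rewrite cycle_subG; apply/normP; rewrite -cycleJ st cycleV.
have le : p.*2 <= #[s] * #[t].
  rewrite -oD -genD (_ : <<[set s; t]>> = <[s]> * <[t]>); last first.
    by rewrite -norm_joinEr //= joing_idl joing_idr.
  by rewrite mul_cardG leq_pmulr // cardG_gt0.
have os : #[s] = 1%N \/ #[s] = p.
  have /(prime_nt_dvdP p_pr) : #[s] %| p by rewrite order_dvdn sp.
  by have [->|ne] := eqVneq #[s] 1%N; [left | right; auto].
move: le; rewrite -muln2.
case: os ot => -> [] -> //; rewrite ?mul1n ?muln1 ?muln2 //.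
- by rewrite leqNgt -addnn ltn_addr // ltnW.
- by rewrite leqNgt -addnn (leq_trans p_gt2) // leq_addr.
- by rewrite -addnn -[X in _ <= X]addn0 leq_add2l leqn0 => /eqP p0; rewrite p0 in p_gt2.
Qed.

(** The cyclic maps s |-> x and t |-> y respect the two conjugation actions, so they glue along the
    semidirect decompositions. *)
Lemma dihedral_isom (gT rT : finGroupType) (D : {group gT}) (N : {group rT})
    (s t : gT) (x y : rT) :
    #[s] = p -> #[t] = 2 -> s ^ t = s^-1 -> <<[set s; t]>> = D ->
    #[x] = p -> #[y] = 2 -> x ^ y = x^-1 -> <<[set x; y]>> = N ->
  exists f : {morphism D >-> rT}, [/\ isom D N f, f s = x & f t = y].
Proof.
move=> os ot st genD ox oy xy genN.
have dxs : #[x] %| #[s] by rewrite os ox.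
have dyt : #[y] %| #[t] by rewrite ot oy.
have defD : <[s]> ><| <[t]> = D by rewrite dihedral_sdprod.
have defN : <[x]> ><| <[y]> = N by rewrite dihedral_sdprod.
have actf : {in <[s]> & <[t]>, morph_act 'J 'J (eltm dxs) (eltm dyt)}.
  move=> _ b /cycleP[i ->]; rewrite cycle2g // !inE => /orP[]/eqP-> /=.
    by rewrite morph1 !conjg1.
  rewrite conjXg st expgVn eltm_id morphV ?mem_cycle //=.
  by rewrite eltmE conjXg xy expgVn.
exists (sdprodm_morphism defD actf); split=> /=.
- apply/isomP; split; last first.
    by rewrite im_sdprodm !im_eltm; have /sdprodP[] := defN.
  rewrite injm_sdprodm !injm_eltm os ot ox oy !dvdnn !im_eltm /=.
  by have [_ _ _ ->] := sdprodP defN.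
- by rewrite sdprodmEl ?cycle_id //=; apply: eltm_id.
- by rewrite sdprodmEr ?cycle_id //=; apply: eltm_id.
Qed.
End DihedralPresentation.

(** * Roots of unity, sqrt 2 and the real root inside the algebraic numbers *)

Section RootsOfUnity.
Local Open Scope ring_scope.

Lemma prim_root_prime (F : fieldType) (p : nat) (a : F) :
  prime p -> a ^+ p = 1 -> a != 1 -> p.-primitive_root a.
Proof.
move=> p_pr ap1 a1; have [m prim_a /(primeP p_pr).2 /orP[]/eqP Dm] :=
  prim_order_exists (prime_gt0 p_pr) ap1; last by rewrite -Dm.
by move: a1; rewrite -[a]expr1 -Dm prim_expr_order // eqxx.
Qed.

Lemma odd_unity_sqr1 (F : fieldType) (p : nat) (a : F) :
  odd p -> a ^+ p = 1 -> a ^+ 2 = 1 -> a = 1.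
Proof.
move=> p_odd ap1 a2; rewrite -ap1 -[p]odd_double_half p_odd exprD -mul2n exprM.
by rewrite a2 expr1n mulr1.
Qed.

Lemma zeta_prim (p : nat) : prime p -> p.-primitive_root (zeta p).
Proof.
move=> p_pr; apply: prim_root_prime => //; rewrite /zeta.
  by rewrite exprAC rootCK ?prime_gt0 // sqrrN expr1n.
rewrite sqrf_eq1 negb_or; apply/andP; split; apply/eqP => E.
  have := rootCK (prime_gt0 p_pr) (-1 : algC).
  by rewrite E expr1n => /eqP; rewrite -addr_eq0 (pnatr_eq0 _ 2).
(* A principal root of degree above 1 is never a negative real. *)
by have := rootC_lt0 (-1 : algC) (prime_gt1 p_pr); rewrite E ltrN10.
Qed.

(* The sign of sqrt 2 is read off the residue of the exponent modulo 8,
   because sqrt 2 = +- (e + e^7) for a primitive 8th root of unity e. *)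
Lemma aut_zeta_sqrt2 (p k : nat) (b : bool) : odd p -> coprime k p ->
  exists u : {rmorphism algC -> algC},
    (forall x, x ^+ p = 1 -> u x = x ^+ k) /\ u (sqrtC 2) = (-1) ^+ b * sqrtC 2.
Proof.
(* Exponent 3 flips the sign: e^3 + e^21 = e^3 + e^5 = -(e^7 + e), because e^4 = -1. *)
move=> p_odd kp; pose c := if b then 3%N else 1%N.
have co8p : coprime 8 p by rewrite (coprimeXl 3 (m := 2)) // coprime2n.
have [m m8 mp] : exists2 m, (m %% 8 = c)%N & (m = k %[mod p])%N.
  exists (chinese 8 p c k); last exact: chinese_modr.
  by rewrite chinese_modl // /c; case: (b).
have com : coprime m (8 * p)%N.
  rewrite coprimeMr -coprime_modl m8 -[coprime m p]coprime_modl mp coprime_modl kp.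
  by rewrite /c; case: (b).
have [u uP] := Qn_aut_exists com; exists u; split=> [x xp1|].
  rewrite uP; first by rewrite -(expr_mod _ xp1) mp expr_mod.
  by rewrite mulnC exprM xp1 expr1n.
have [e e_prim] : {e : algC | 8.-primitive_root e} by apply: C_prim_root_exists.
have e8 := prim_expr_order e_prim.
have e4 : e ^+ 4 = -1.
  have : (e ^+ 4) ^+ 2 == 1 by rewrite -exprM e8.
  by rewrite sqrf_eq1 => /orP[|/eqP//]; rewrite -(prim_order_dvd e_prim).
have eS i : e ^+ (4 + i) = - e ^+ i by rewrite exprD e4 mulN1r.
pose s := e + e ^+ 7.
have s2 : s ^+ 2 = 2.
  rewrite sqrrD -exprM -exprS e8 (exprD _ 8 6) e8 mul1r (eS 2%N).
  by rewrite addrAC subrr add0r.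
have us : u s = (-1) ^+ b * s.
  have ue : u e = e ^+ c.
    rewrite uP; first by rewrite -(expr_mod _ e8) m8.
    by rewrite exprM e8 expr1n.
  rewrite /s rmorphD rmorphXn /= ue -exprM /c; case: (b); last by rewrite mul1r.
  rewrite (exprD _ 8 13) e8 (exprD _ 8 5) e8 !mul1r (eS 1%N) (eS 3%N) expr1 mulN1r.
  by rewrite opprD opprK addrC.
have : sqrtC 2 ^+ 2 == s ^+ 2 by rewrite sqrtCK s2.
by rewrite eqf_sqr => /orP[]/eqP->; rewrite ?rmorphN us ?mulrN.
Qed.

(** Such an x is a root of the monic integer polynomial (X^p - 1)^2 - 2. For odd p this applies both
    to the real root and to minus its inverse. *)
Lemma Aint_root_sqrt2_unit (p : nat) (x : algC) :
  (0 < p)%N -> (x ^+ p - 1) ^+ 2 = 2 -> x \in Aint.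
Proof.
move=> p_gt0 xp; pose q : {poly int} := ('X^p - 1) ^+ 2 - 2%:P.
apply: (root_monic_Aint (p := map_poly intr q)).
- rewrite /root /q rmorphB rmorphXn rmorphB rmorph1 /= map_polyXn map_polyC.
  by rewrite !hornerE xp subrr.
- apply: monic_map; rewrite monicE /q lead_coefDl.
    by rewrite lead_coef_exp lead_coefXnsubC // expr1n.
  rewrite size_polyN; apply: leq_ltn_trans (size_polyC_leq1 _) _.
  have := size_exp ('X^p - 1 : {poly int}) 2; rewrite size_XnsubC //=.
  by case: (size _) => [|[|n]] //; case: (p) p_gt0.
- by apply/polyOverP => i; rewrite coef_map intr_int.
Qed.

Lemma rootp_1sqrt2_gt1 (p : nat) : (0 < p)%N -> 1 < rootp_1sqrt2 p.
Proof.
move=> p_gt0; rewrite /rootp_1sqrt2 -{1}(rootC1 _ p_gt0) ltr_rootC ?ler01 //.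
- by rewrite ltrDl sqrtC_gt0 ltr0n.
- by rewrite nnegrE ler01.
- by rewrite nnegrE addr_ge0 ?ler01 ?sqrtC_ge0 ?ler0n.
Qed.

(* The difference would be a positive integer, so the root would be at least
   the golden ratio, whose cube already exceeds 1 + sqrt 2. *)
Lemma rootp_1sqrt2_subV_irrat (p : nat) : (2 < p)%N -> odd p ->
  rootp_1sqrt2 p - (rootp_1sqrt2 p)^-1 \notin Crat.
Proof.
move=> p_gt2 p_odd; set rho := rootp_1sqrt2 p; apply/negP => rat_d.
have p_gt0 : (0 < p)%N by apply: leq_trans p_gt2.
have rho_gt1 : 1 < rho := rootp_1sqrt2_gt1 p_gt0.
have rho_gt0 : 0 < rho := lt_trans ltr01 rho_gt1.
have rhop : rho ^+ p = 1 + sqrtC 2 by rewrite rootCK.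
have Ar : rho \in Aint.
  by apply: (Aint_root_sqrt2_unit p_gt0); rewrite rhop addrC addKr sqrtCK.
have ArV : - rho^-1 \in Aint.
  apply: (Aint_root_sqrt2_unit p_gt0).
  rewrite exprNn -signr_odd p_odd expr1 mulN1r exprVn rhop.
  suff -> : (1 + sqrtC 2)^-1 = sqrtC 2 - 1 :> algC.
    by rewrite opprB addrAC subrr sub0r sqrrN sqrtCK.
  have nz : (1 + sqrtC 2 : algC) != 0 by rewrite -rhop expf_neq0 // gt_eqF.
  apply: (mulIf nz); rewrite mulVf // [1 + _]addrC -subr_sqr sqrtCK expr1n.
  by rewrite -[2]/(1 + 1) addrK.
have int_d : rho - rho^-1 \is a Num.int by rewrite Cint_rat_Aint // rpredD.
have d_gt0 : 0 < rho - rho^-1.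
  by rewrite subr_gt0 (lt_trans _ rho_gt1) // invf_lt1.
have d_ge1 : 1 <= rho - rho^-1.
  by have := norm_intr_ge1 int_d (lt0r_neq0 d_gt0); rewrite gtr0_norm.
have sq_ge : rho + 1 <= rho ^+ 2.
  have := ler_wpM2l (ltW rho_gt0) d_ge1.
  by rewrite mulr1 mulrBr mulfV ?gt_eqF // -expr2 lerBrDr.
(* rho^3 >= rho^2 + rho >= (rho + 1) + rho >= 3. *)
have cube_ge : 3 <= rho ^+ 3.
  have := ler_wpM2l (ltW rho_gt0) sq_ge; rewrite -exprS mulrDr mulr1 -expr2.
  apply: le_trans; apply: le_trans (lerD sq_ge (lexx _)).
  by rewrite (natrD _ 2 1) (natrD _ 1 1) !lerD // ltW.
have : 3 <= 1 + sqrtC 2 :> algC.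
  by rewrite -rhop (le_trans cube_ge) // ler_weXn2l // ltW.
rewrite (natrD _ 1 2) lerD2l => le2.
have : 2 ^+ 2 <= sqrtC 2 ^+ 2 :> algC by rewrite lerXn2r // nnegrE ?sqrtC_ge0.
by rewrite sqrtCK -natrX ler_nat.
Qed.

End RootsOfUnity.

(** * Automorphisms of S and their values on z, w and r *)

Section PureExtension.
Local Open Scope ring_scope.
Variables (p : nat) (p_pr : prime p) (p_odd : odd p).
Variables (L : splittingFieldType rat) (iota : {rmorphism L -> algC}) (r z : L).
Hypotheses (Hr : iota r = rootp_1sqrt2 p) (Hz : iota z = zeta p).

Local Notation K := <<1; z>>%VS.
Local Notation S := <<K; r>>%VS.
Local Notation w := (r ^+ p - 1).

Let p_gt0 : (0 < p)%N. Proof. exact: prime_gt0. Qed.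
Let p_gt2 : (2 < p)%N. Proof. by case: (p) p_pr p_odd => [|[|[|]]]. Qed.

Lemma z_prim : p.-primitive_root z.
Proof. by rewrite -(fmorph_primitive_root iota) Hz zeta_prim. Qed.

Let zp1 : z ^+ p = 1. Proof. exact: prim_expr_order z_prim. Qed.
Let zXp1 i : (z ^+ i) ^+ p = 1. Proof. by rewrite exprAC zp1 expr1n. Qed.

Let iota_r_gt0 : 0 < iota r.
Proof. by rewrite Hr (lt_trans ltr01) ?rootp_1sqrt2_gt1. Qed.

Lemma r_neq0 : r != 0.
Proof. by rewrite -(fmorph_eq0 iota) gt_eqF. Qed.

Lemma z_neq0 : z != 0.
Proof. by have := oner_neq0 L; rewrite -zp1 expf_eq0 p_gt0. Qed.

Lemma iota_w : iota w = sqrtC 2.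
Proof. by rewrite rmorphB rmorphXn rmorph1 /= Hr rootCK // addrC addKr. Qed.

Lemma w_sqr : w ^+ 2 = 2.
Proof.
by apply: (fmorph_inj iota); rewrite rmorphXn /= iota_w sqrtCK rmorph_nat.
Qed.

Lemma eq_expp_mulz a b : b != 0 -> a ^+ p = b ^+ p -> exists j, a = z ^+ j * b.
Proof.
move=> b0 ab; have : (a / b) ^+ p = 1 by rewrite expr_div_n ab divff ?expf_neq0.
by case/(prim_rootP z_prim) => j E; exists j; rewrite -E divfK.
Qed.

Lemma rmorph_z (f : {rmorphism L -> L}) : exists i, f z = z ^+ i.
Proof.
have : f z ^+ p = 1 by rewrite -rmorphXn zp1 rmorph1.
by case/(prim_rootP z_prim) => j ->; exists j.
Qed.

Lemma rmorph_w (f : {rmorphism L -> L}) : f w = w \/ f w = - w.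
Proof.
have : f w ^+ 2 == w ^+ 2 by rewrite -rmorphXn /= w_sqr rmorph_nat.
by rewrite eqf_sqr => /orP[]/eqP; [left | right].
Qed.

Lemma rmorph_r_fix (f : {rmorphism L -> L}) :
  f w = w -> exists j, f r = z ^+ j * r.
Proof.
rewrite rmorphB rmorph1 rmorphXn => /addIr; apply: eq_expp_mulz r_neq0.
Qed.

(** Here r^p = 1 + w goes to 1 - w = -1/(1 + w); as p is odd, -f(r) and 1/r have the same p-th
    power. *)
Lemma rmorph_r_opp (f : {rmorphism L -> L}) :
  f w = - w -> exists j, f r = - (z ^+ j / r).
Proof.
move=> fw; have : (- f r) ^+ p = r^-1 ^+ p.
  have rp0 : r ^+ p != 0 by rewrite expf_neq0 ?r_neq0.
  rewrite exprNn -signr_odd p_odd mulN1r exprVn; apply: (mulIf rp0).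
  rewrite mulVf // -rmorphXn.
  have -> : f (r ^+ p) = 1 - w.
    by rewrite -[r ^+ p in LHS](subrK 1) rmorphD fw rmorph1 addrC.
  rewrite opprB -[X in _ * X](subrK 1) -subr_sqr w_sqr expr1n.
  by rewrite (natrD _ 1 1) addrK.
case/eq_expp_mulz => [|j E]; first by rewrite invr_eq0 r_neq0.
by exists j; rewrite -E opprK.
Qed.

Lemma z_in_S : z \in S. Proof. exact/(subvP (subv_adjoin _ _))/memv_adjoin. Qed.
Lemma r_in_S : r \in S. Proof. exact: memv_adjoin. Qed.
Let K_sub_S : (K <= S)%VS. Proof. exact: subv_adjoin. Qed.
Lemma w_in_S : w \in S. Proof. by rewrite rpredB ?rpred1 ?rpredX ?r_in_S. Qed.

(** The fixed field of x y^-1 contains z and a. Leaving a free covers the three uses a = r, a = z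
    and a = w. *)
Lemma gal_eq_on a (x y : gal_of S) : a \in S ->
  x z = y z -> x a = y a -> {in <<K; a>>%VS, x =1 y}.
Proof.
move=> Sa xyz xya; pose v := (x * y^-1)%g.
have fix_v b : b \in S -> (b \in fixedField [set v]) = (x b == y b).
  move=> Sb; apply/(fixedFieldP Sb)/eqP => [fixb | xyb c /set1P->].
    by have := fixb v (set11 _); rewrite -[in x b](mulgKV y x) -/v (galM v) // => ->.
  by rewrite galM // xyb -galM // mulgV gal_id.
have sub : (<<K; a>> <= fixedField [set v])%VS.
  apply/FadjoinP; rewrite fix_v // xya eqxx; split=> //.
  by apply/FadjoinP; rewrite sub1v fix_v ?z_in_S // xyz eqxx.
move=> b /(subvP sub) fb; apply/eqP; rewrite -fix_v //.
by have [] := mem_fixedFieldP fb.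
Qed.

Lemma gal_ext (x y : gal_of S) : x z = y z -> x r = y r -> x = y.
Proof.
by move=> xyz xyr; apply/eqP/gal_eqP => b; apply: (gal_eq_on r_in_S).
Qed.

Lemma mem_gal1 (x : gal_of S) : x \in 'Gal(S / 1%VS)%g.
Proof. by rewrite gal_kHom ?sub1v // k1AHom. Qed.

Lemma mem_galK (x : gal_of S) : (x \in 'Gal(S / K)%g) = (x z == z).
Proof.
apply/idP/eqP => [xK | xz]; first exact: fixed_gal K_sub_S xK (memv_adjoin _ _).
rewrite gal_kHom //; apply/kAHomP => b Kb.
rewrite -[RHS](gal_id S); apply: (gal_eq_on z_in_S); rewrite ?gal_id //.
by rewrite (subvP (subv_adjoin _ _)).
Qed.

(** This is the normality of S: the images of r are of the form z^j r or -z^j / r. *)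
Lemma AEnd_S (f : 'AEnd(L)) : (f @: S <= S)%VS.
Proof.
rewrite !aimg_adjoin aimg1.
have fz : f z \in S.
  by have [i ->] := rmorph_z f; rewrite rpredX ?z_in_S.
apply/FadjoinP; split; first by apply/FadjoinP; rewrite sub1v fz.
have [/rmorph_r_fix|/rmorph_r_opp] := rmorph_w f; case=> j ->.
  by rewrite rpredM ?rpredX ?z_in_S ?r_in_S.
by rewrite rpredN rpredM ?rpredV ?rpredX ?z_in_S ?r_in_S.
Qed.

(** Brings complex conjugation and the cyclotomic automorphisms down to S. *)
Lemma aut_gal (nu : {rmorphism algC -> algC}) :
  exists x : gal_of S, forall a, a \in S -> iota (x a) = nu (iota a).
Proof.
have [nu0 nuE] := restrict_aut_to_normal_num_field iota nu.
pose f : 'AEnd(L) := AHom (linfun_is_ahom nu0).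
exists (gal S f) => a Sa; rewrite galK ?AEnd_S //=.
by rewrite lfunE /= nuE.
Qed.

Lemma galois_S : galois 1 S.
Proof.
apply/and3P; split; rewrite ?sub1v //; last first.
  apply/forall_inP => f _; have := AEnd_S f; rewrite -kAut1E.
  by case/andP.
apply/separableP => a _; apply: pcharf0_separable => q.
by rewrite -(fmorph_pchar iota) pchar_num.
Qed.

Lemma conj_gal : exists c : gal_of S, c z = z^-1 /\ c r = r.
Proof.
have [c cE] := aut_gal Num.conj; exists c; split; apply: (fmorph_inj iota).
  rewrite cE ?z_in_S // fmorphV invC_norm.
  have /eqP -> : `|iota z| == 1.
    by rewrite -(pexpr_eq1 p_gt0) // -normrX -rmorphXn zp1 rmorph1 normr1.
  by rewrite expr1n invr1 mul1r.
by rewrite cE ?r_in_S //; apply: conj_Creal; rewrite gtr0_real.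
Qed.

(* Otherwise complex conjugation commutes with the group on r, every image of r
   is real, and r - 1/r is rational. *)
Lemma r_notin : r \notin <<K; w>>%VS.
Proof.
apply/negP => Fr; have [c [cz cr]] := conj_gal.
have cw : c w = w by rewrite rmorphB rmorphXn rmorph1 /= cr.
have real_x (x : gal_of S) : c (x r) = x r.
  have [i xz] := rmorph_z x.
  (* Each automorphism takes z to a power of z and w to w or -w, so x and c commute on Q(z, w). *)
  have E : {in <<K; w>>%VS, (x * c)%g =1 (c * x)%g}.
    apply: gal_eq_on; rewrite ?w_in_S // !galM ?z_in_S ?w_in_S //.
      by rewrite xz cz rmorphXn fmorphV /= cz xz exprVn.
    by rewrite cw; have [->|->] := rmorph_w x; rewrite ?rmorphN /= cw.
  by have := E r Fr; rewrite !galM ?r_in_S // cr.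
(* A power of z fixed by conjugation equals its inverse, so its order divides both 2 and the odd
   p. *)
have real_zX i : c (z ^+ i) = z ^+ i -> z ^+ i = 1.
  rewrite rmorphXn /= cz => zi; apply: (odd_unity_sqr1 p_odd) => //.
  by rewrite expr2 -{1}zi exprVn mulVf // expf_neq0 // z_neq0.
(* Exchanging r and -1/r preserves r - 1/r. *)
have rat_d : r - r^-1 \in 1%VS.
  have /galois_fixedField <- := galois_S.
  apply/fixedFieldP; first by rewrite rpredB ?rpredV ?r_in_S.
  move=> x _; rewrite rmorphB fmorphV /=.
  have := real_x x; have [/rmorph_r_fix|/rmorph_r_opp] := rmorph_w x; case=> j xr.
    rewrite xr rmorphM /= cr => /(mulIf r_neq0)/real_zX->.
    by rewrite mul1r.
  rewrite xr rmorphN rmorphM fmorphV /= cr => /oppr_inj.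
  move/(mulIf _) => /(_ (invr_neq0 r_neq0))/real_zX->.
  by rewrite mul1r invrN invrK opprK addrC.
have := rootp_1sqrt2_subV_irrat p_gt2 p_odd.
rewrite -Hr -fmorphV -rmorphB; case/vlineP: rat_d => k ->.
by rewrite rmorphZ_num rmorph1 mulr1 Crat_rat.
Qed.

Lemma gal_expg_r (x : gal_of S) j n :
  x z = z -> x r = z ^+ j * r -> (x ^+ n)%g z = z /\ (x ^+ n)%g r = (z ^+ j) ^+ n * r.
Proof.
move=> xz xr; elim: n => [|n [IHz IHr]]; first by rewrite expg0 !gal_id mul1r.
rewrite expgSr !galM ?z_in_S ?r_in_S // IHz IHr rmorphM rmorphXn /= rmorphXn /= xz xr.
by rewrite exprSr mulrA.
Qed.

(** As r lies outside Q(z, w), some automorphism fixing z and w moves r to z^j r with z^j != 1.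
    Since p is prime, z^j is primitive, and a power of the automorphism sends r to z r. *)
Lemma sigma_exists : exists x : gal_of S, x z = z /\ x r = z * r.
Proof.
have [x [xz xw xr]] : exists x : gal_of S, [/\ x z = z, x w = w & x r != r].
  have sub : (1 <= <<K; w>> <= S)%VS.
    by rewrite sub1v; apply/FadjoinP; rewrite subv_adjoin w_in_S.
  have /galois_fixedField fixF := galoisS sub galois_S.
  have /andP[_ subS] := sub.
  have := r_notin; rewrite -fixF => /(fixedFieldP r_in_S) nfix.
  have /forall_inPn[x xF xr] : ~~ [forall x in 'Gal(S / <<K; w>>)%g, x r == r].
    by apply/negP => /forall_inP all_fix; apply: nfix => x /all_fix/eqP.
  exists x; split=> //; apply: (fixed_gal subS xF); last exact: memv_adjoin.
  by apply: (subvP (subv_adjoin _ _)); apply: memv_adjoin.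
have [j xrE] := rmorph_r_fix xw.
have zj_prim : p.-primitive_root (z ^+ j).
  apply: prim_root_prime => //; apply: contraNneq xr => zj.
  by rewrite xrE zj mul1r.
have [n zE] := prim_rootP zj_prim zp1.
by exists (x ^+ n)%g; have [-> ->] := gal_expg_r n xz xrE; rewrite -zE.
Qed.

Lemma gal_zw (k : nat) (b : bool) : coprime k p ->
  exists x : gal_of S, x z = z ^+ k /\ x w = (-1) ^+ b * w.
Proof.
move=> kp; have [u [uz uw]] := aut_zeta_sqrt2 b p_odd kp.
have [x xE] := aut_gal u; exists x; split; apply: (fmorph_inj iota).
  by rewrite xE ?z_in_S // uz ?rmorphXn // -rmorphXn zp1 rmorph1.
by rewrite xE ?w_in_S // rmorphM rmorph_sign iota_w.
Qed.

(** An automorphism z |-> z^k fixing w sends r to z^j r; a power of sigma applied afterwards cancels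
    z^j. *)
Lemma gal_unit (k : nat) : coprime k p ->
  exists x : gal_of S, x z = z ^+ k /\ x r = r.
Proof.
move=> kp; have [s [sz sr]] := sigma_exists.
have [x [xz xw]] := gal_zw false kp; rewrite mul1r in xw.
have [j xr] := rmorph_r_fix xw; have [i zi] : exists i, z ^+ i * z ^+ j = 1.
  (* The exponent (p - 1) j represents -j modulo p. *)
  exists (p.-1 * j)%N; rewrite -exprD -mulSnr prednK //.
  by rewrite exprM zp1 expr1n.
have [siz sir] := gal_expg_r (j := 1) i sz sr; rewrite expr1 in sir.
exists (x * s ^+ i)%g; rewrite !galM ?z_in_S ?r_in_S // xz xr.
by rewrite rmorphM !rmorphXn /= siz sir mulrCA mulrA zi mul1r.
Qed.

(** An automorphism fixing z and negating w gives r |-> -z^j / r; composing with sigma^j removes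
    z^j. *)
Lemma tau_exists : exists x : gal_of S, x z = z /\ x r = - r^-1.
Proof.
have [s [sz sr]] := sigma_exists.
have [x [xz xw]] := gal_zw true (coprime1n p); rewrite mulN1r in xw.
have [j xr] := rmorph_r_opp xw.
have [siz sir] := gal_expg_r (j := 1) j sz sr; rewrite expr1 in sir.
exists (x * s ^+ j)%g; rewrite !galM ?z_in_S ?r_in_S // xz xr expr1 siz.
rewrite rmorphN rmorphM fmorphV rmorphXn /= siz sir invfM mulrA divff ?mul1r //.
by rewrite expf_neq0 ?z_neq0.
Qed.

(** * Dihedral relations between sigma and tau, and generation of the group over K *)

Section Generators.
Variables s t : gal_of S.
Hypotheses (sz : s z = z) (sr : s r = z * r) (tz : t z = z) (tr : t r = - r^-1).

Lemma sigmaX n : (s ^+ n)%g z = z /\ (s ^+ n)%g r = z ^+ n * r.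
Proof. by have := gal_expg_r (j := 1) n sz sr; rewrite expr1. Qed.

Lemma sigma_order : #[s]%g = p.
Proof.
apply: nt_prime_order => //.
  have [snz snr] := sigmaX p.
  by apply: gal_ext; rewrite ?snz ?snr gal_id // zp1 mul1r.
apply/eqP => s1; move: sr; rewrite s1 gal_id -{1}[r]mul1r => /(mulIf r_neq0) z1.
have := prim_order_dvd z_prim 1; rewrite expr1 -z1 eqxx dvdn1.
by move=> /eqP p1; have := p_gt2; rewrite p1.
Qed.

Lemma tau_order : #[t]%g = 2%N.
Proof.
apply: nt_prime_order => //.
  apply: gal_ext; rewrite expgS expg1 galM ?z_in_S ?r_in_S // gal_id ?tz // tr.
  by rewrite rmorphN fmorphV /= tr invrN invrK opprK.
(* If tau were trivial, the positive real r would equal the negative -1/r. *)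
apply/eqP => t1; move: tr; rewrite t1 gal_id => /(congr1 iota) E.
have := iota_r_gt0; rewrite E rmorphN fmorphV oppr_gt0 invr_lt0.
by rewrite lt_gtF.
Qed.

Lemma sigma_tau : (s ^ t = s^-1)%g.
Proof.
(* The relation is put in the form s t s = t, which involves no inverse automorphism. *)
apply: (mulIg s); rewrite mulVg; apply: (mulgI t).
rewrite mulgA -conjgC mulg1 -mulgA.
apply: gal_ext; rewrite !galM ?memv_gal ?z_in_S ?r_in_S //.
  by rewrite sz tz sz.
rewrite sr tr rmorphM /= tz tr mulrN rmorphN rmorphM fmorphV /= sz sr invfM.
by rewrite mulrA divff ?z_neq0 // mul1r.
Qed.

(** The sign of x on w separates the rotations s^j from the reflections s^j t. *)
Lemma sigma_tau_gen : <<[set s; t]>>%g = 'Gal(S / K)%g.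
Proof.
apply/eqP; rewrite eqEsubset gen_subG; apply/andP; split; apply/subsetP => x.
  by rewrite mem_galK !inE => /orP[]/eqP->; rewrite ?sz ?tz.
rewrite mem_galK => /eqP xz.
have ss : s \in <<[set s; t]>>%g by rewrite mem_gen // !inE eqxx.
have tt : t \in <<[set s; t]>>%g by rewrite mem_gen // !inE eqxx orbT.
have [/rmorph_r_fix|/rmorph_r_opp] := rmorph_w x; case=> j xr.
  have -> : x = (s ^+ j)%g.
    by have [sjz sjr] := sigmaX j; apply: gal_ext; rewrite ?xz ?xr.
  exact: groupX.
have -> : x = (s ^+ j * t)%g.
  have [sjz sjr] := sigmaX j.
  apply: gal_ext; rewrite galM ?z_in_S ?r_in_S // ?xz ?xr ?sjz ?sjr ?tz //.
  by rewrite rmorphM rmorphXn /= tz tr mulrN.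
by rewrite groupM // groupX.
Qed.

End Generators.
End PureExtension.

(** Supplies generators for the first claim, where none are given. *)
Lemma dihedral_pres_exists (p : nat) : (1 < p)%N ->
  exists s t : 'D_(p.*2), dihedral_pres ('D_(p.*2))%g p s t.
Proof.
move=> p_gt1; have := Grp_dihedral p_gt1 [set: 'D_(p.*2)]%G.
rewrite homg_refl => /esym/existsP[[s t] /eqP[genD sp t2 st]].
exists s, t; split; split; rewrite ?inE //.
by rewrite -[RHS]genD joing_idl joing_idr.
Qed.

(* Kept folded so that simplification does not turn the underlying group
   operations of {unit 'Z_p} into ring operations. *)
Definition unitZp_nat (p : nat) (u : {unit 'Z_p}) : nat := val u.

(** * Units modulo p as exponents of a primitive root of unity *)

Section UnitsZp.
Local Open Scope ring_scope.
Variables (p : nat) (p_gt1 : (1 < p)%N) (F : fieldType) (z : F).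
Hypothesis z_prim : p.-primitive_root z.

Lemma expr_unitZpM (u v : {unit 'Z_p}) :
  z ^+ unitZp_nat (u * v)%g = z ^+ (unitZp_nat u * unitZp_nat v).
Proof.
rewrite -(prim_expr_mod z_prim (_ * _)%N) /unitZp_nat /=.
by congr (z ^+ (_ %% _)); apply: Zp_cast.
Qed.

Lemma expr_unitZp_inj (u v : {unit 'Z_p}) :
  z ^+ unitZp_nat u = z ^+ unitZp_nat v -> u = v.
Proof.
move/eqP; rewrite (eq_prim_root_expr z_prim) /unitZp_nat => /eqP uv.
do 2 apply: val_inj; rewrite /=.
have lt (a : 'Z_p) : (a < p)%N by rewrite -[X in (_ < X)%N](Zp_cast p_gt1).
by rewrite -(modn_small (lt (val u))) uv modn_small.
Qed.

Lemma coprime_unitZp (u : {unit 'Z_p}) : coprime (unitZp_nat u) p.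
Proof.
by rewrite /unitZp_nat coprime_sym -(unitZpE _ p_gt1) natr_Zp; apply: (valP u).
Qed.

Lemma unitZp_expr_exists (i : nat) : coprime i p ->
  exists u : {unit 'Z_p}, z ^+ unitZp_nat u = z ^+ i.
Proof.
rewrite coprime_sym -(unitZpE _ p_gt1) => ui; exists (FinRing.unit 'Z_p ui).
by rewrite /unitZp_nat /= val_Zp_nat // (prim_expr_mod z_prim).
Qed.

Lemma expr_unitZp1 : z ^+ unitZp_nat (1 : {unit 'Z_p})%g = z.
Proof. by rewrite /unitZp_nat /= modn_small ?expr1 // Zp_cast. Qed.

End UnitsZp.

(** * The Galois groups over K and over the rationals *)

Theorem theorem4p10 (p : nat) (Hp : prime p) (Hodd : odd p)
  (L : splittingFieldType rat) (iota : {rmorphism L -> algC}) (r z : L)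
  (Hr : iota r = rootp_1sqrt2 p) (Hz : iota z = zeta p) :
  let S := <<<<1; z>>; r>>%VS in
  let K := <<1; z>>%VS in
  (* (1) *)
  ('Gal(S / K) \isog 'D_(p.*2))%g /\
  (* (2) *)
  (forall s t : 'D_(p.*2), dihedral_pres ('D_(p.*2))%g p s t ->
   exists (N H : {group gal_of S})
          (f : {morphism ('D_(p.*2))%g >-> gal_of S})
          (g : {morphism units_Zp p >-> gal_of S}),
     [/\ (N ><| H)%g = ('Gal(S / 1%VS))%g,
         isom ('D_(p.*2))%g N f,
         isom (units_Zp p) H g
       & forall u, u \in units_Zp p ->
           (f s ^ (g u)^-1 = f (s ^+ (val u : nat)))%g /\
           (f t ^ (g u)^-1 = f t)%g]).
Proof.
move=> S K; have p_gt1 := prime_gt1 Hp.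
have [sg [sgz sgr]] := sigma_exists Hp Hodd Hr Hz.
have [tu [tuz tur]] := tau_exists Hp Hodd Hr Hz.
(* Any presenting pair is matched with sigma and tau, whose values on z and r are known. *)
have dih s t : dihedral_pres ('D_(p.*2))%g p s t ->
    exists f : {morphism ('D_(p.*2))%g >-> gal_of S},
      [/\ isom ('D_(p.*2))%g ('Gal(S / K))%g f, f s = sg & f t = tu].
  move=> Dst; have := Dst; case=> -[_ _ genD] [_ _ st].
  have [os ot] := dihedral_pres_orders (D := [set: 'D_(p.*2)]%G) Hp Hodd
    (card_dihedral p_gt1) Dst.
  apply: (dihedral_isom (D := [set: 'D_(p.*2)]%G) (N := 'Gal(S / K)%G)
    Hodd os ot st genD).
  - exact: (sigma_order Hp Hodd Hr Hz sgz sgr).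
  - exact: (tau_order Hp Hr).
  - exact: (sigma_tau Hp Hz).
  - exact: (sigma_tau_gen Hp Hodd Hr Hz).
split=> [|s t Dst].
  have [s [t /dih[f [isof _ _]]]] := dihedral_pres_exists p_gt1.
  by rewrite isog_sym; apply: isom_isog isof.
have [f [isof fs ft]] := dih s t Dst.
have zS : z \in S := z_in_S r z; have rS : r \in S := r_in_S r z.
have z_pr : (p.-primitive_root z)%R := z_prim Hp Hz.
have ext := @gal_ext L r z.
(* Products apply the left factor first, so (h u) sigma (h u)^-1 sends r to (h u)^-1 (z r). For this
   to be z^u r, [h u] must raise z to the inverse of u. *)
have hE (u : {unit 'Z_p}) : exists x : gal_of S,
    x z = (z ^+ unitZp_nat (u^-1)%g)%R /\ x r = r.
  exact: (gal_unit Hp Hodd Hr Hz (coprime_unitZp p_gt1 _)).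
have [h hP] := fin_all_exists hE.
have hM : {in units_Zp p &, {morph h : u v / (u * v)%g}}.
  move=> u v _ _; have [[uz ur] [vz vr]] := (hP u, hP v).
  have [uvz uvr] := hP (u * v)%g.
  apply: ext; rewrite galM //; last by rewrite ur vr uvr.
  rewrite uvz uz rmorphXn /= vz -exprM  -(expr_unitZpM p_gt1 z_pr).
  by rewrite invMg.
pose g := Morphism hM.
have hK u : h u z = z -> u = 1%g.
  have [-> _] := hP u => E; apply: (invg_inj); rewrite invg1.
  by apply: (expr_unitZp_inj p_gt1 z_pr); rewrite expr_unitZp1.
(* The inverse of y takes z to a power of z, which x fixes. *)
have nor (x y : gal_of S) : x \in 'Gal(S / K)%g -> (x ^ y)%g \in 'Gal(S / K)%g.
  rewrite !mem_galK => /eqP xz.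
  have [i yz] := rmorph_z Hp Hz ((y^-1)%g : gal_of S).
  rewrite /conjg !galM ?memv_gal // yz rmorphXn /= xz -yz -galM // mulVg.
  by rewrite gal_id.
exists 'Gal(S / K)%G, (g @* units_Zp p)%G, f, g; split=> //.
- rewrite sdprodE /=.
  + apply/eqP; rewrite eqEsubset; apply/andP; split; apply/subsetP => x _.
      exact: mem_gal1.
    (* If x raises z to the unit u, then x and [h u^-1] agree on z, so they differ by an element of
       Gal(S/K). *)
    have [i xz] := rmorph_z Hp Hz x.
    have [|u uE] := unitZp_expr_exists p_gt1 z_pr (i := i).
      by rewrite -(prim_root_exp_coprime _ z_pr) -xz fmorph_primitive_root.
    have [vz _] := hP u^-1%g; rewrite invgK uE in vz.
    rewrite -[x](mulgKV (h u^-1%g)) mem_mulg //.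
      by rewrite mem_galK galM // xz -vz -galM // mulgV gal_id.
    by apply: (mem_morphim g); rewrite inE.
  + apply/subsetP => y _; rewrite inE; apply/subsetP => _ /imsetP[x xN ->].
    exact: nor.
  + apply/trivgP/subsetP => x /setIP[]; rewrite mem_galK => /eqP xz.
    case/morphimP => u _ _ xu; have /hK u1 : h u z = z by move: xz; rewrite xu.
    by rewrite xu u1; apply/set1P; apply: (morph1 g).
- apply/isomP; split=> //; apply/subsetP => u /morphpreP[_ /set1P /= hu].
  by rewrite inE; apply/eqP/hK; rewrite hu gal_id.
- move=> u _; rewrite -/(unitZp_nat u); have [uz ur] := hP u.
  have fD a : a \in ('D_(p.*2))%g by rewrite inE.
  have [skz skr] := sigmaX sgz sgr (unitZp_nat u).
  split.
    (* The conjugation law becomes (h u) sigma = sigma^u (h u); both sides send r to z r. *)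
    rewrite morphX // fs; apply: (mulIg (h u)).
    rewrite /conjg invgK mulgA mulgKV.
    apply: ext; rewrite !galM // ?skz ?skr ?uz ?ur ?sgr //.
      by rewrite rmorphXn /= sgz.
    rewrite rmorphM rmorphXn /= uz ur -exprM -(expr_unitZpM p_gt1 z_pr) mulVg.
    by rewrite expr_unitZp1.
  rewrite ft; apply: (mulIg (h u)); rewrite /conjg invgK mulgA mulgKV.
  apply: ext; rewrite !galM // ?uz ?ur ?tuz ?tur.
    by rewrite uz rmorphXn /= tuz.
  by rewrite rmorphN fmorphV /= ur.
Qed.
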